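(* Let $K$ be a commutative integral domain with identity, $n\ge1$, and let $\mathcal F=\sum_{|\alpha|=0}^{\infty}a_\alpha D^\alpha$ ($a_\alpha\in K$) be a linear differential operator of infinite order on $K[x_1,\dots,x_n]'$ such that $a_0$ (the coefficient with $\alpha=(0,\dots,0)$) is an invertible element of $K$. Let $T\in K[x_1,\dots,x_n]'$. Then the unique solution $u\in K[x_1,\dots,x_n]'$ of the equation $\mathcal F u=T$ is the convolution of the fundamental solution $\mathcal E$ of $\mathcal F$ and the copolynomial $T$: $u=\mathcal E*T$.
   Context: A copolynomial over $K$ is a $K$-linear map $T:K[x_1,\dots,x_n]\to K$; $K[x_1,\dots,x_n]'$ is the $K$-module of copolynomials, and $(T,p)$ denotes the value of $T$ at $p$. For $\alpha\in\mathbb N_0^n$, $|\alpha|=\sum_j\alpha_j$, $D^\alpha=\frac{\partial^{|\alpha|}}{\partial x_1^{\alpha_1}\cdots\partial x_n^{\alpha_n}}$, and $(D^\alpha T,p)=(-1)^{|\alpha|}(T,D^\alpha p)$. The operator $\mathcal F=\sum_{|\alpha|=0}^\infty a_\alpha D^\alpha$ acts by $(\mathcal F T,p)=\sum_{|\alpha|\le m}a_\alpha (D^\alpha T,p)$ where $m=\deg p$. The $\delta$-function is the copolynomial $(\delta,p)=p(0)$. When $a_0$ is invertible, $\mathcal F$ is bijective on $K[x_1,\dots,x_n]'$, and the fundamental solution of $\mathcal F$ is $\mathcal E=\mathcal F^{-1}\delta$, i.e. the unique copolynomial with $\mathcal F\mathcal E=\delta$. For a polynomial $p$ of degree $m$,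 the polynomials $\frac{D^\alpha p}{\alpha!}\in K[x_1,\dots,x_n]$ are defined (over any $K$) by $p(x+h)=\sum_{|\alpha|\le m}\frac{D^\alpha p(x)}{\alpha!}h^\alpha$. The convolution of $T_1,T_2\in K[x_1,\dots,x_n]'$ is the copolynomial $(T_1*T_2,p)=\sum_{|\alpha|\le m}\left(T_1,\frac{D^\alpha p}{\alpha!}\right)(T_2,x^\alpha)$, $m=\deg p$. *)

(* Defs.v *)
From HB Require Import structures.
From mathcomp Require Import all_boot all_order all_algebra.
From mathcomp Require Export mpoly.

Set Implicit Arguments.
Unset Strict Implicit.
Unset Printing Implicit Defensive.

Import GRing.Theory.

Local Open Scope ring_scope.

(* Linear forms are taken with scaling operator *%R, so that their codomain is
   K itself and not the regular module K^o. *)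
Notation copoly K n := {scalar {mpoly K[n]}}.

Section TruncatedSums.
Variables (n : nat) (V : nmodType).

Lemma sum_bmnm_widen (k l : nat) (F : 'X_{1..n} -> V) :
  (k <= l)%N -> (forall m, (k <= mdeg m)%N -> F m = 0) ->
  \sum_(m : 'X_{1..n < k}) F m = \sum_(m : 'X_{1..n < l}) F m.
Proof.
move=> le_kl F0.
rewrite [RHS](bigID (fun m : 'X_{1..n < l} => mdeg m < k)%N) /=.
rewrite [X in _ + X]big1 ?addr0; last by move=> m; rewrite -leqNgt => /F0.
pose g (m : 'X_{1..n < k}) : 'X_{1..n < l} :=
  BMultinom (leq_trans (bmdeg m) le_kl).
case: (posnP #|{: 'X_{1..n < k}}|) => [k0|/card_gt0P[m0 _]].
  rewrite big1 => [|m _]; last by have := card0_eq k0 m.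
  by rewrite big1 // => m lt_mk; have := card0_eq k0 (BMultinom lt_mk).
pose h (m : 'X_{1..n < l}) : 'X_{1..n < k} := insubd m0 (val m).
rewrite (reindex g) /=; last first.
  exists h => [m _|m lt_mk]; apply: (@val_inj _ _ _); rewrite /= /h.
    by rewrite -[LHS]/(val _) val_insubd /= (bmdeg m).
  by rewrite -[LHS]/(val (insubd _ _)) val_insubd; case: ifP => // /negP[].
by apply: eq_big => // m; rewrite (bmdeg m).
Qed.

End TruncatedSums.

Section Taylor.
Variables (K : idomainType) (n : nat).
Implicit Types (p : {mpoly K[n]}) (al : 'X_{1..n}).

(* p(x + h) as a polynomial in h whose coefficients are polynomials in x:
   the variables h_i are the outer ones, the variables x_i the inner ones. *)
Definition mshift p : {mpoly {mpoly K[n]}[n]} :=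
  mmap (mpolyC n (R:={mpoly K[n]}) \o mpolyC n (R:=K))
    (fun i => ('X_i)%:MP + 'X_i) p.

(* D^al p / al!, defined over any K as the coefficient of h^al in p(x + h). *)
Definition dderivm al p : {mpoly K[n]} := (mshift p)@_al.

Lemma mshiftE p k : (msize p <= k)%N ->
  mshift p = \sum_(m : 'X_{1..n < k})
    ((p@_m)%:MP)%:MP * mmap1 (fun i => ('X_i)%:MP + 'X_i) m.
Proof. exact: mmapE. Qed.

Lemma mshift_is_linear c p q :
  mshift (c *: p + q) = (c%:MP : {mpoly K[n]}) *: mshift p + mshift q.
Proof. by rewrite /mshift mmapD mmapZ /= mul_mpolyC. Qed.

Lemma dderivm_is_linear al : linear (dderivm al).
Proof.
by move=> c p q; rewrite /dderivm mshift_is_linear mcoeffD mcoeffZ mul_mpolyC.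
Qed.

HB.instance Definition _ al :=
  GRing.isLinear.Build K {mpoly K[n]} {mpoly K[n]} _ (dderivm al)
    (dderivm_is_linear al).

Lemma msizeM_bound (R : idomainType) (p q : {mpoly R[n]}) a b :
  (msize p <= a.+1)%N -> (msize q <= b.+1)%N -> (msize (p * q) <= (a + b).+1)%N.
Proof.
move=> pa qb; have [->|p0] := eqVneq p 0; first by rewrite mul0r msize0.
have [->|q0] := eqVneq q 0; first by rewrite mulr0 msize0.
rewrite msizeM //.
have : (msize p + msize q <= a.+1 + b.+1)%N by apply: leq_add.
by rewrite addSn addnS; case: (_ + _)%N.
Qed.

Lemma msize_mshift p : (msize (mshift p) <= msize p)%N.
Proof.
rewrite (mshiftE (leqnn _)).
apply: (leq_trans (msize_sum _ _ _)); apply/bigmax_leqP => m _.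
apply: leq_trans (bmdeg m).
rewrite -[mdeg m]add0n; apply: msizeM_bound.
  by rewrite msizeC leq_b1.
rewrite /mmap1 mdegE.
apply: (big_ind2 (fun (q : {mpoly {mpoly K[n]}[n]}) d => msize q <= d.+1)%N).
- by rewrite msize1.
- by move=> q1 d1 q2 d2; apply: msizeM_bound.
move=> i _; elim: (m i) => [|k IHk]; first by rewrite expr0 msize1.
rewrite exprS -[k.+1]add1n; apply: msizeM_bound => //.
apply: leq_trans (msizeD_le _ _) _.
by rewrite geq_max msizeX mdeg1 msizeC (leq_trans (leq_b1 _)).
Qed.

Lemma dderivm_eq0 al p : (msize p <= mdeg al)%N -> dderivm al p = 0.
Proof.
move=> le_p; apply/memN_msupp_eq0/msize_mdeg_ge.
exact: leq_trans (msize_mshift p) le_p.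
Qed.

Lemma mderivm_eq0 al p : (msize p <= mdeg al)%N -> p^`M[al] = 0.
Proof.
move=> le_p; apply/mpolyP => m; rewrite mcoeff_mderivm mcoeff0.
rewrite memN_msupp_eq0 ?mul0rn //; apply: msize_mdeg_ge.
by rewrite mdegD (leq_trans le_p) ?leq_addr.
Qed.

End Taylor.

Section Copolynomials.
Variables (K : idomainType) (n : nat).
Implicit Types (T : copoly K n) (p : {mpoly K[n]}) (al : 'X_{1..n}).
Implicit Types (a : 'X_{1..n} -> K).

Definition delta_fun p : K := p.@[fun=> 0].

Lemma delta_is_linear : scalar delta_fun.
Proof. by move=> c p q; rewrite /delta_fun mevalD mevalZ. Qed.

HB.instance Definition _ :=
  GRing.isLinear.Build K {mpoly K[n]} K _ delta_fun delta_is_linear.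

Definition delta : copoly K n := delta_fun.

Definition coderivm_fun al T p : K := (-1) ^+ mdeg al * T p^`M[al].

Lemma coderivm_is_linear al T : scalar (coderivm_fun al T).
Proof.
by move=> c p q; rewrite /coderivm_fun !linearP /= mulrDr mulrCA.
Qed.

HB.instance Definition _ al T :=
  GRing.isLinear.Build K {mpoly K[n]} K _ (coderivm_fun al T)
    (coderivm_is_linear al T).

Definition coderivm al T : copoly K n := coderivm_fun al T.

(* The range mdeg al < msize p is |al| <= deg p when p != 0, and is empty when
   p = 0. *)
Definition diffop_fun a T p : K :=
  \sum_(al : 'X_{1..n < msize p}) a al * coderivm al T p.

Lemma diffop_funE a T p k : (msize p <= k)%N ->
  diffop_fun a T p = \sum_(al : 'X_{1..n < k}) a al * coderivm al T p.
Proof.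
move=> le_pk.
apply: (sum_bmnm_widen (F := fun al => a al * coderivm al T p)) => // al le_p.
by rewrite /= /coderivm_fun mderivm_eq0 // linear0 !mulr0.
Qed.

Lemma diffop_is_linear a T : scalar (diffop_fun a T).
Proof.
move=> c p q.
pose k := maxn (msize (c *: p + q)) (maxn (msize p) (msize q)).
rewrite !(@diffop_funE _ _ _ k) ?leq_max ?leqnn ?orbT //.
rewrite mulr_sumr -big_split /=; apply: eq_bigr => al _.
by rewrite linearP mulrDr mulrCA.
Qed.

HB.instance Definition _ a T :=
  GRing.isLinear.Build K {mpoly K[n]} K _ (diffop_fun a T)
    (diffop_is_linear a T).

Definition diffop a T : copoly K n := diffop_fun a T.

Definition coconv_fun T1 T2 p : K :=
  \sum_(al : 'X_{1..n < msize p}) T1 (dderivm al p) * T2 'X_[al].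

Lemma coconv_funE T1 T2 p k : (msize p <= k)%N ->
  coconv_fun T1 T2 p =
  \sum_(al : 'X_{1..n < k}) T1 (dderivm al p) * T2 'X_[al].
Proof.
move=> le_pk.
apply: (sum_bmnm_widen (F := fun al => T1 (dderivm al p) * T2 'X_[al])) => //.
by move=> al le_p; rewrite dderivm_eq0 // linear0 mul0r.
Qed.

Lemma coconv_is_linear T1 T2 : scalar (coconv_fun T1 T2).
Proof.
move=> c p q.
pose k := maxn (msize (c *: p + q)) (maxn (msize p) (msize q)).
rewrite !(@coconv_funE _ _ _ k) ?leq_max ?leqnn ?orbT //.
rewrite mulr_sumr -big_split /=; apply: eq_bigr => al _.
by rewrite !linearP /= mulrDl mulrA.
Qed.

HB.instance Definition _ T1 T2 :=
  GRing.isLinear.Build K {mpoly K[n]} K _ (coconv_fun T1 T2)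
    (coconv_is_linear T1 T2).

Definition coconv T1 T2 : copoly K n := coconv_fun T1 T2.

Definition fundamental_solution a (E : copoly K n) : Prop :=
  unique (fun E' : copoly K n => diffop a E' = delta) E.

End Copolynomials.

Arguments delta {K n}.

(* Main.v *)
Require Import Defs.
From mathcomp Require Import all_boot all_order all_algebra.
From HB Require Import structures.
From Stdlib Require Import FunctionalExtensionality ProofIrrelevance.

(** By duality everything takes place on polynomials.  The operator F with
    coefficients a is the transpose of the endomorphism
    L p = sum_al (-1)^|al| a_al D^al p of K[x], in the sense that
    (F u, p) = (u, L p) for all u and p ([diffop_dualE]).  Since a_0 is
    invertible and every other term of L lowers the degree, L is a_0 times the
    identity up to terms of lower degree, hence bijective ([diffop_dual_inj],
    [diffop_dual_surj]).  So F u = T determines u on the whole range of L, that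
    is everywhere, and E = delta o L^-1 is the fundamental solution.

    It remains to see that F (E * T) = T.  The endomorphism L has constant
    coefficients, so it commutes with the divided derivatives D^al / al!
    ([diffop_dual_dderivm]), and therefore
      (E * T, L p) = sum_al (E, L (D^al p / al!)) (T, x^al)
                   = sum_al (D^al p / al!)(0) (T, x^al).
    By Taylor's formula at the origin ([delta_dderivm]) the number
    (D^al p / al!)(0) is the coefficient of x^al in p, and the sum is (T, p).

    Divided derivatives are coefficients of p(x + h), where p |-> p(x + h) is a
    ring morphism; hence identities about them follow by Leibniz' rule from the
    case of constants and variables. *)

Set Implicit Arguments.
Unset Strict Implicit.
Unset Printing Implicit Defensive.

Import GRing.Theory.
Local Open Scope ring_scope.

(** * Polynomials and divided derivatives *)

Section Polynomials.
Variables (K : idomainType) (n : nat).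
Implicit Types (p q : {mpoly K[n]}) (al be m : 'X_{1..n}).

Lemma mpoly_ring_ind (P : {mpoly K[n]} -> Prop) :
  (forall c, P c%:MP) -> (forall i, P 'X_i) ->
  (forall p q, P p -> P q -> P (p + q)) ->
  (forall p q, P p -> P q -> P (p * q)) -> forall p, P p.
Proof.
move=> PC PX PD PM; elim/mpolyind => [|c m p _ _ Pp].
  by rewrite -mpolyC0; apply: PC.
apply: PD => //; rewrite -mul_mpolyC; apply: (PM) => //.
have P1 : P 1 by rewrite -mpolyC1.
rewrite mpolyXE_id; apply: (big_ind P P1 PM) => i _.
by elim: (m i) => [|k IHk]; rewrite ?expr0 // exprS; apply: PM.
Qed.

Lemma msize_leP p k :
  (forall m, (k <= mdeg m)%N -> p@_m = 0) -> (msize p <= k)%N.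
Proof.
move=> p0; rewrite msizeE big_seq.
apply: (big_ind (fun j => j <= k)%N) => // [x y xk yk|m].
  by rewrite geq_max xk.
by rewrite mcoeff_msupp ltnNge; apply: contraNN => /p0->.
Qed.

(** Compare the coefficients of h^al in p(x + h) q(x + h). *)
Lemma dderivmM al p q :
  dderivm al (p * q) =
  \sum_(k : 'X_{1..n < (mdeg al).+1, (mdeg al).+1} | al == (k.1 + k.2)%MM)
    dderivm k.1 p * dderivm k.2 q.
Proof. by rewrite /dderivm /mshift rmorphM mcoeffM. Qed.

Lemma dderivmC al c :
  dderivm al (c%:MP : {mpoly K[n]}) = (c * (al == 0%MM)%:R)%:MP.
Proof.
by rewrite /dderivm /mshift mmapC /= mcoeffC mpolyCM -mpolyC_nat.
Qed.

Lemma dderivmX al i :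
  dderivm al ('X_i : {mpoly K[n]}) =
  'X_i *+ (al == 0%MM) + ((U_(i)%MM == al)%:R)%:MP.
Proof.
rewrite /dderivm /mshift mmapX mmap1U mcoeffD mcoeffC mcoeffX mulr_natr.
by rewrite mpolyC_nat.
Qed.

(** Coefficientwise differentiation in x satisfies Leibniz' rule with respect
    to the product of polynomials in h, as does the derivation of p, so it is
    enough to compare both on constants and variables. *)
Lemma dderivm_mderiv al i p : dderivm al p^`M(i) = (dderivm al p)^`M(i).
Proof.
elim/mpoly_ring_ind: p al => [c|j|p q IHp IHq|p q IHp IHq] al.
- by rewrite mderivC linear0 dderivmC mderivC.
- rewrite dderivmX mderivD mderivC mderivMn addr0 !mderivX mnm1E.
  have [->|_] := eqVneq j i; last by rewrite !scale0r linear0 mul0rn.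
  rewrite !scale1r -{1 3}[U_(i)%MM]add0m !addmK mpolyX0 -mpolyC1 dderivmC mul1r.
  by rewrite -[RHS]mulr_natr mpolyC1 mul1r mpolyC_nat.
- by rewrite mderivD !linearD /= IHp IHq.
- rewrite mderivM linearD /= !dderivmM linear_sum /= -big_split /=.
  by apply: eq_bigr => k _; rewrite mderivM IHp IHq.
Qed.

Lemma dderivm_mderivm al be p : dderivm al p^`M[be] = (dderivm al p)^`M[be].
Proof.
rewrite !mderivm_foldr; elim: (flatten _) => //= i s IHs.
by rewrite dderivm_mderiv IHs.
Qed.

(** Taylor's formula at the origin: setting x = 0 in p(x + h) gives p(h). *)
Lemma delta_dderivm al p : delta (dderivm al p) = p@_al.
Proof.
rewrite /= /delta_fun.
elim/mpoly_ring_ind: p al => [c|i|p q IHp IHq|p q IHp IHq] al.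
- by rewrite dderivmC mevalC mcoeffC.
- by rewrite dderivmX mevalD mevalMn mevalXU mul0rn add0r mevalC mcoeffX.
- have -> : dderivm al (p + q) = dderivm al p + dderivm al q by exact: linearD.
  by rewrite mevalD mcoeffD; congr (_ + _).
- rewrite dderivmM mcoeffM raddf_sum; apply: eq_bigr => k _.
  by rewrite /= mevalM; congr (_ * _).
Qed.

Lemma msize_mderivm p al : (msize p^`M[al] <= msize p - mdeg al)%N.
Proof.
apply: msize_leP => m le_m; rewrite mcoeff_mderivm memN_msupp_eq0 ?mul0rn //.
by apply: msize_mdeg_ge; rewrite mdegD -leq_subLR.
Qed.

End Polynomials.

(** * The transposed operator *)

Section Dual.
Variables (K : idomainType) (n : nat) (a : 'X_{1..n} -> K).
Implicit Types (p q : {mpoly K[n]}) (al : 'X_{1..n}) (u v : copoly K n).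

(** Linear forms are packed with proofs of their linearity, which have to be
    identified as well. *)
Lemma copoly_ext u v : u =1 v -> u = v.
Proof.
case: u v => [f [[fD] [fZ]]] [g [[gD] [gZ]]] /= /functional_extensionality fg.
subst g.
by rewrite (proof_irrelevance _ fD gD) (proof_irrelevance _ fZ gZ).
Qed.

(** The endomorphism L.  The range mdeg al < msize p covers all nonzero
    derivatives of p, so that the infinite sum is finite on each p. *)
Definition diffop_dual p : {mpoly K[n]} :=
  \sum_(al : 'X_{1..n < msize p}) ((-1) ^+ mdeg al * a al) *: p^`M[al].

Lemma diffop_dual_widen p k : (msize p <= k)%N ->
  diffop_dual p =
  \sum_(al : 'X_{1..n < k}) ((-1) ^+ mdeg al * a al) *: p^`M[al].
Proof.
move=> le_pk; pose F al := ((-1) ^+ mdeg al * a al) *: p^`M[al].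
apply: (@sum_bmnm_widen _ _ _ _ F le_pk) => al le_p.
by rewrite /F mderivm_eq0 ?scaler0.
Qed.

Lemma diffop_dual_is_linear : linear diffop_dual.
Proof.
move=> c p q.
pose k := maxn (msize (c *: p + q)) (maxn (msize p) (msize q)).
rewrite !(@diffop_dual_widen _ k) ?leq_max ?leqnn ?orbT //.
rewrite scaler_sumr -big_split /=; apply: eq_bigr => al _.
by rewrite linearP scalerDr !scalerA [c * _]mulrC.
Qed.

HB.instance Definition _ :=
  GRing.isLinear.Build K {mpoly K[n]} {mpoly K[n]} _ diffop_dual
    diffop_dual_is_linear.

Lemma diffop_dualE u p : diffop a u p = u (diffop_dual p).
Proof.
rewrite [LHS]/= /diffop_fun /diffop_dual linear_sum; apply: eq_bigr => al _.
by rewrite linearZ /= /coderivm_fun mulrCA mulrA.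
Qed.

(** L has constant coefficients and divided derivatives commute with ordinary
    ones. *)
Lemma diffop_dual_dderivm al p :
  diffop_dual (dderivm al p) = dderivm al (diffop_dual p).
Proof.
pose k := maxn (msize (dderivm al p)) (msize p).
rewrite !(@diffop_dual_widen _ k) ?leq_max ?leqnn ?orbT // linear_sum.
by apply: eq_bigr => be _; rewrite linearZ /= dderivm_mderivm.
Qed.

Lemma msize_diffop_dualB p :
  (msize (diffop_dual p - a 0%MM *: p) <= (msize p).-1)%N.
Proof.
rewrite (@diffop_dual_widen _ (msize p).+1) //.
have lt0 : (mdeg (0%MM : 'X_{1..n}) < (msize p).+1)%N by rewrite mdeg0.
(* The term al = 0 is a_0 p; it cancels, and the others lower the degree. *)
rewrite (bigD1 (BMultinom lt0)) //= mdeg0 expr0 mul1r mderivm0m.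
rewrite addrAC subrr add0r.
apply: leq_trans (msize_sum _ _ _) _; apply/bigmax_leqP => al nz_al.
apply: leq_trans (msizeZ_le _ _) _; apply: leq_trans (msize_mderivm _ _) _.
rewrite -subn1 leq_sub2l // lt0n mdeg_eq0; apply: contraNN nz_al => /eqP al0.
by apply/eqP/val_inj.
Qed.

Hypothesis a0_unit : a 0%MM \is a GRing.unit.

Let a0_neq0 : a 0%MM != 0.
Proof. by apply: contraTneq a0_unit => ->; rewrite unitr0. Qed.

(** If L p = 0 then a_0 p = - (L p - a_0 p) has lower degree than p. *)
Lemma diffop_dual_inj : injective diffop_dual.
Proof.
apply: raddf_inj => p Lp0; apply/eqP; rewrite -msize_poly_eq0.
have := msize_diffop_dualB p; rewrite Lp0 sub0r msizeN msizeZ //.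
by case: (msize p) => // k; rewrite ltnn.
Qed.

(** By induction on the degree: L (a_0^-1 p) agrees with p up to a polynomial
    of lower degree, which is already a value of L. *)
Lemma diffop_dual_surj p : exists q, diffop_dual q == p.
Proof.
have [k] := ubnP (msize p); elim: k p => // k IHk p; rewrite ltnS => le_pk.
have [->|p_neq0] := eqVneq p 0; first by exists 0; rewrite linear0.
pose q := (a 0%MM)^-1 *: p.
have qE : a 0%MM *: q = p by rewrite scalerA divrr ?scale1r.
have lt_k : (msize (diffop_dual q - p) < k)%N.
  apply: leq_trans le_pk; rewrite -[X in _ - X]qE.
  rewrite -[X in (_ < X)%N]prednK ?ltnS; last by rewrite lt0n msize_poly_eq0.
  apply: leq_trans (msize_diffop_dualB q) _.
  by rewrite -subn1 -[(_.-1)%N]subn1 leq_sub2r ?msizeZ_le.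
have [r /eqP rE] := IHk _ lt_k.
by exists (q - r); rewrite linearB /= rE opprB addrC subrK.
Qed.

Definition diffop_dual_inv p : {mpoly K[n]} := xchoose (diffop_dual_surj p).

Lemma diffop_dual_invK : cancel diffop_dual_inv diffop_dual.
Proof. by move=> p; apply/eqP/(xchooseP (diffop_dual_surj p)). Qed.

Lemma diffop_dualK : cancel diffop_dual diffop_dual_inv.
Proof. by move=> p; apply: diffop_dual_inj; rewrite diffop_dual_invK. Qed.

HB.instance Definition _ :=
  GRing.isLinear.Build K {mpoly K[n]} {mpoly K[n]} _ diffop_dual_inv
    (can2_linear diffop_dualK diffop_dual_invK).

Lemma diffop_inj u v : diffop a u = diffop a v -> u = v.
Proof.
move=> Fuv; apply: copoly_ext => p.
by rewrite -[p]diffop_dual_invK -!diffop_dualE Fuv.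
Qed.

(** * The fundamental solution *)

Definition fund_sol_fun p : K := delta (diffop_dual_inv p).

Lemma fund_sol_is_linear : scalar fund_sol_fun.
Proof. by move=> c p q; rewrite /fund_sol_fun !linearP. Qed.

HB.instance Definition _ :=
  GRing.isLinear.Build K {mpoly K[n]} K _ fund_sol_fun fund_sol_is_linear.

Definition fund_sol : copoly K n := fund_sol_fun.

Lemma diffop_fund_sol : diffop a fund_sol = delta.
Proof.
apply: copoly_ext => p; rewrite diffop_dualE [LHS]/= /fund_sol_fun.
by rewrite diffop_dualK.
Qed.

End Dual.

(** Write (E * T, L p) and (T, p) as sums over the same range of al and compare
    term by term: the left factor is
    (E, D^al (L p) / al!) = (E, L (D^al p / al!)) = (F E, D^al p / al!)
                          = (delta, D^al p / al!),
    the coefficient of x^al in p. *)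
Lemma diffop_coconv (K : idomainType) (n : nat) (a : 'X_{1..n} -> K)
    (E T : copoly K n) :
  diffop a E = delta -> diffop a (coconv E T) = T.
Proof.
move=> FE; apply: copoly_ext => p; rewrite diffop_dualE [LHS]/=.
pose k := maxn (msize (diffop_dual a p)) (msize p).
rewrite (@coconv_funE _ _ _ _ _ k) ?leq_maxl //.
rewrite [p in RHS](@mpolywE _ _ k) ?leq_maxr // linear_sum.
apply: eq_bigr => al _; rewrite linearZ -diffop_dual_dderivm -diffop_dualE FE.
by rewrite delta_dderivm.
Qed.

Theorem corollary5p4 (K : idomainType) (n : nat) (hn : (0 < n)%N)
    (a : 'X_{1..n} -> K) (ha : a 0%MM \is a GRing.unit) (T : copoly K n) :
  exists2 E : copoly K n, fundamental_solution a E &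
    unique (fun u : copoly K n => diffop a u = T) (coconv E T).
Proof.
have FE := diffop_fund_sol ha.
exists (fund_sol ha).
  by split=> // E' FE'; apply: (diffop_inj ha); rewrite FE FE'.
have FET := diffop_coconv T FE.
by split=> // u Fu; apply: (diffop_inj ha); rewrite FET Fu.
Qed.
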